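(* For all $f=(f_n)_{n=0}^{\infty}$, $g=(g_n)_{n=0}^{\infty}\in l_{\mathrm{fin}}$ and all $n\in\mathbb{N}_0$, $$(f\star g)_n=\sum_{\substack{i,j,k\in\mathbb{N}_0\\ i+j+k=n}}\frac{(i+j)!\,(j+k)!}{i!\,j!\,k!}\,f_{i+j}\,g_{j+k}.$$
   Context: $\mathbb{N}_0=\{0,1,2,\dots\}$. $l_{\mathrm{fin}}$ is the space of all finite (i.e. finitely supported) sequences $f=(f_n)_{n=0}^\infty$ of complex numbers. The Newton polynomials are $(x)_0:=1$ and $(x)_n:=x(x-1)\cdots(x-n+1)$ for $n\ge 1$; $(x)_n$ has degree $n$. Let $I:l_{\mathrm{fin}}\to\mathbb{C}[x]$ be the linear bijection $(If)(x):=\sum_{n=0}^\infty f_n\,(x)_n$. The product $\star$ on $l_{\mathrm{fin}}$ is defined by $f\star g:=I^{-1}(If\cdot Ig)$, where $\cdot$ is the pointwise product of polynomials. *)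

(* Defs.v *)
From HB Require Import structures.
From mathcomp Require Import all_boot all_order all_algebra.
From mathcomp Require Import finmap reals complex.

Set Implicit Arguments.
Unset Strict Implicit.
Unset Printing Implicit Defensive.

Import Order.TTheory GRing.Theory Num.Theory.
Local Open Scope ring_scope.
Local Open Scope complex_scope.

Definition lfin (R : realType) := {fsfun nat -> R[i] with 0}.

Definition newton_poly (R : realType) (n : nat) : {poly R[i]} :=
  \prod_(k < n) ('X - (k%:R)%:P).

Definition newtonI (R : realType) (f : lfin R) : {poly R[i]} :=
  \sum_(n <- finsupp f) f n *: newton_poly R n.

Section NewtonBijection.
Variable R : realType.
Implicit Types (f g : lfin R) (p : {poly R[i]}) (c : nat -> R[i]).

Lemma size_newton_poly n : size (newton_poly R n) = n.+1.
Proof. by rewrite size_prod_XsubC /index_enum -enumT size_enum_ord. Qed.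

Lemma newton_polynn n : (newton_poly R n)`_n = 1.
Proof.
have := monic_prod_XsubC (index_enum 'I_n) xpredT (fun k => (k%:R : R[i])).
by move/monicP; rewrite lead_coefE -/(newton_poly R n) size_newton_poly.
Qed.

Lemma newtonI_widen f N : (forall n, (N <= n)%N -> f n = 0) ->
  newtonI f = \sum_(n < N) f n *: newton_poly R n.
Proof.
move=> f0; rewrite /newtonI.
rewrite -(big_mkord xpredT (fun n => f n *: newton_poly R n)) /index_iota subn0.
rewrite [RHS](bigID (fun n => n \in finsupp f)) /= [X in _ = _ + X]big1 ?addr0.
  rewrite -[RHS]big_filter; apply/perm_big/uniq_perm.
  - exact: fset_uniq.
  - by rewrite filter_uniq // iota_uniq.
  move=> n; rewrite mem_filter mem_iota /= add0n.
  apply/idP/andP => [nf|[]//]; split => //; rewrite ltnNge; apply/negP => /f0.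
  by apply/eqP; rewrite -mem_finsupp.
by move=> n nf; rewrite fsfun_dflt // scale0r.
Qed.

Lemma size_newton_sum c N :
  (size (\sum_(n < N) c n *: newton_poly R n)%R <= N)%N.
Proof.
apply: (leq_trans (size_sum _ _ _)); apply/bigmax_leqP => n _.
by rewrite (leq_trans (size_scale_leq (c n) _)) // size_newton_poly.
Qed.

Lemma newton_sum_inj c N : \sum_(n < N) c n *: newton_poly R n = 0 ->
  forall n, (n < N)%N -> c n = 0.
Proof.
elim: N => [//|N IH]; rewrite big_ord_recr /= => s0.
have cN : c N = 0.
  move/(congr1 (fun p : {poly R[i]} => p`_N)): s0.
  rewrite coefD coefZ newton_polynn mulr1 coef0.
  by rewrite nth_default ?add0r // size_newton_sum.
move: s0; rewrite cN scale0r addr0 => /IH cn n.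
by rewrite ltnS leq_eqVlt => /orP[/eqP->//|/cn].
Qed.

Lemma newton_sum_surj N p : (size p <= N)%N ->
  exists c, p = \sum_(n < N) c n *: newton_poly R n.
Proof.
elim: N p => [|N IH] p sp.
  by exists (fun=> 0); rewrite big_ord0; apply/eqP; rewrite -size_poly_leq0.
have [|c pc] := IH (p - p`_N *: newton_poly R N).
  apply/leq_sizeP => j; rewrite leq_eqVlt coefB coefZ => /orP[/eqP<-|Nj].
    by rewrite newton_polynn mulr1 subrr.
  rewrite (nth_default _ (leq_trans sp Nj)).
  by rewrite [X in _ * X]nth_default ?size_newton_poly // mulr0 subrr.
exists (fun n => if n == N then p`_N else c n).
rewrite big_ord_recr /= eqxx -[LHS](subrK (p`_N *: newton_poly R N)) pc.
by congr (_ + _); apply: eq_bigr => n _; rewrite ltn_eqF.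
Qed.

Lemma lfin_bounded f : exists N, forall n, (N <= n)%N -> f n = 0.
Proof.
exists (\max_(n <- finsupp f) n).+1 => n Nn; apply: fsfun_dflt.
apply/negP => nf; move: Nn; rewrite ltnNge => /negP; apply.
exact: (@leq_bigmax_seq _ _ xpredT id).
Qed.

Lemma newtonI_inj : injective (@newtonI R).
Proof.
move=> f g fg; have [M fM] := lfin_bounded f; have [N gN] := lfin_bounded g.
pose K := maxn M N.
have fK n : (K <= n)%N -> f n = 0.
  by move=> Kn; apply: fM; apply: leq_trans Kn; apply: leq_maxl.
have gK n : (K <= n)%N -> g n = 0.
  by move=> Kn; apply: gN; apply: leq_trans Kn; apply: leq_maxr.
have /(newton_sum_inj (c := fun n => f n - g n)) d0 : \sum_(n < K) (f n - g n) *: newton_poly R n = 0.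
  under eq_bigr do rewrite scalerBl.
  by rewrite sumrB -(newtonI_widen fK) -(newtonI_widen gK) fg subrr.
apply/fsfunP => n; have [Kn|/d0/eqP] := leqP K n; first by rewrite fK ?gK.
by rewrite subr_eq0 => /eqP.
Qed.

Lemma newtonI_surj p : exists f, newtonI f == p.
Proof.
have [c pc] := newton_sum_surj (leqnn (size p)).
pose f : lfin R := [fsfun n in [fset n in iota 0 (size p)]%fset => c n | 0].
have fE n : f n = if (n < size p)%N then c n else 0.
  by rewrite fsfunE inE mem_iota.
exists f; rewrite (@newtonI_widen f (size p)) => [|n]; last first.
  by rewrite fE leqNgt => /negPf->.
by apply/eqP; rewrite [RHS]pc; apply: eq_bigr => n _; rewrite fE ltn_ord.
Qed.

Definition newtonI_inv p : lfin R := xchoose (newtonI_surj p).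

Lemma newtonI_invK : cancel newtonI_inv (@newtonI R).
Proof. by move=> p; apply/eqP/(xchooseP (newtonI_surj p)). Qed.

Lemma newtonIK : cancel (@newtonI R) newtonI_inv.
Proof. by move=> f; apply: newtonI_inj; rewrite newtonI_invK. Qed.

Lemma newtonI_bij : bijective (@newtonI R).
Proof. by exists newtonI_inv; [exact: newtonIK | exact: newtonI_invK]. Qed.

End NewtonBijection.

Definition star (R : realType) (f g : lfin R) : lfin R :=
  newtonI_inv (newtonI f * newtonI g).

(* Main.v *)
(** Since [(m)_n = n! * 'C(m, n)], evaluating [newtonI f] at a natural number
    [m] gives the binomial transform of [F a := a! f_a]. If [L] is the linear
    functional [X^a Y^b |-> F a * G b], the product of the binomial transforms
    of [F] and [G] is the image under [L] of
    [(1 + X)^m (1 + Y)^m = (1 + (X + Y + XY))^m], i.e. the binomial transform of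
    [n |-> L ((X + Y + XY)^n)]. The binomial transform is injective, so
    [n! (f * g)_n = L ((X + Y + XY)^n)], and the trinomial theorem applied to
    [X + XY + Y] gives the formula. *)

Require Import Defs.
From mathcomp Require Import all_boot all_order all_algebra.
From mathcomp Require Import finmap reals complex.
From mathcomp Require Import ring zify.

Set Implicit Arguments.
Unset Strict Implicit.
Unset Printing Implicit Defensive.

Import Order.TTheory GRing.Theory Num.Theory.
Local Open Scope ring_scope.

(** Expanding [(y + z) + x] and then [z + y] by the binomial theorem yields the coefficient as a
    product of two binomials. *)
Lemma trinomial_exprDn (A : comNzRingType) (x y z : A) n :
  (x + y + z) ^+ n =
  \sum_(i < n.+1) \sum_(j < n.+1) \sum_(k < n.+1 | (i + j + k == n)%N)
    (x ^+ i * y ^+ j * z ^+ k) *+ ('C(n, i) * 'C(n - i, j)).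
Proof.
rewrite -addrA addrC exprDn; apply: eq_bigr => i _.
rewrite addrC exprDn mulr_suml -sumrMnl.
(* Widening the range of [j] only adds empty sums: for [j > n - i] no [k] has [i + j + k = n]. *)
have lin : ((n - i).+1 <= n.+1)%N by rewrite ltnS leq_subr.
rewrite (big_ord_widen _ (fun j => z ^+ (n - i - j) * y ^+ j *+ 'C(n - i, j)
  * x ^+ i *+ 'C(n, i)) lin) big_mkcond /=.
apply: eq_bigr => j _; case: ifP => [ji|/negbT ji].
  have kn : (n - i - j < n.+1)%N by lia.
  rewrite (big_pred1 (Ordinal kn)) /= => [|k]; last first.
    by rewrite /pred1 /= -val_eqE /=; move: ji (ltn_ord i); lia.
  rewrite mulrnAl -mulrnA mulnC; congr (_ *+ _).
  by rewrite mulrC [_ * y ^+ j]mulrC mulrA.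
by rewrite big_pred0 // => k; move: ji (ltn_ord i); lia.
Qed.

Lemma trinomial_coefE n i j k : (i + j + k)%N = n ->
  ('C(n, i) * 'C(n - i, j) * (i`! * j`! * k`!))%N = n`!.
Proof.
move=> ijk; have lein : (i <= n)%N by lia.
have lejn : (j <= n - i)%N by lia.
rewrite -(bin_fact lein) -(bin_fact lejn); have -> : (n - i - j)%N = k by lia.
lia.
Qed.

(* The linear functional sending [X^a Y^b] to [F a * G b] for [a, b < N],
   where [X] is ['X%:P] and [Y] is ['X]. *)
Definition umbral (A : comNzRingType) (N : nat) (F G : nat -> A)
    (P : {poly {poly A}}) : A :=
  \sum_(b < N) \sum_(a < N) P`_b`_a * (F a * G b).

Section Umbral.
Variables (A : comNzRingType) (N : nat) (F G : nat -> A).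

Lemma umbral_sum I (r : seq I) (Q : pred I) (P : I -> {poly {poly A}}) :
  umbral N F G (\sum_(i <- r | Q i) P i) =
  \sum_(i <- r | Q i) umbral N F G (P i).
Proof.
rewrite exchange_big; apply: eq_bigr => b _.
rewrite exchange_big; apply: eq_bigr => a _.
by rewrite !coef_sum mulr_suml.
Qed.

Lemma umbralMn P n : umbral N F G (P *+ n) = umbral N F G P *+ n.
Proof.
rewrite -sumrMnl; apply: eq_bigr => b _; rewrite -sumrMnl.
by apply: eq_bigr => a _; rewrite !coefMn mulrnAl.
Qed.

(** [p%:P * q^:P] is p(X) q(Y), with coefficient p_a q_b at X^a Y^b, so the double sum factors. *)
Lemma umbral_tensor (p q : {poly A}) :
  umbral N F G (p%:P * q^:P) =
  (\sum_(a < N) p`_a * F a) * (\sum_(b < N) q`_b * G b).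
Proof.
rewrite mulr_sumr; apply: eq_bigr => b _; rewrite mulr_suml.
by apply: eq_bigr => a _; rewrite coefCM coef_map coefMC mulrACA.
Qed.

Lemma umbral_monomial a b : (a < N)%N -> (b < N)%N ->
  umbral N F G ('X%:P ^+ a * 'X ^+ b) = F a * G b.
Proof.
move=> aN bN; rewrite -polyC_exp -(map_polyXn polyC) umbral_tensor.
have pick (H : nat -> A) c : (c < N)%N -> \sum_(d < N) ('X^c)`_d * H d = H c.
  move=> cN; rewrite (bigD1 (Ordinal cN)) //= coefXn eqxx mul1r big1 ?addr0 //.
  by move=> d; rewrite -val_eqE /= coefXn => /negPf->; rewrite mul0r.
by rewrite !pick.
Qed.

End Umbral.

Lemma coef_expr1DX (A : comNzRingType) m a :
  ((1 + 'X : {poly A}) ^+ m)`_a = 'C(m, a)%:R.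
Proof.
rewrite exprDn coef_sum.
under eq_bigr do rewrite expr1n mul1r coefMn coefXn.
have [am|ma] := ltnP a m.+1.
  rewrite (bigD1 (Ordinal am)) //= eqxx big1 ?addr0 // => i.
  by rewrite -val_eqE /= eq_sym => /negPf->; rewrite mul0rn.
rewrite bin_small // big1 // => i _.
by rewrite gtn_eqF ?mul0rn // (leq_trans (ltn_ord i)).
Qed.

Lemma binomial_transformM (A : comNzRingType) (F G : nat -> A) m :
  (\sum_(a < m.+1) F a *+ 'C(m, a)) * (\sum_(b < m.+1) G b *+ 'C(m, b)) =
  \sum_(n < m.+1)
    (\sum_(i < n.+1) \sum_(j < n.+1) \sum_(k < n.+1 | (i + j + k == n)%N)
      F (i + j)%N * G (j + k)%N *+ ('C(n, i) * 'C(n - i, j))) *+ 'C(m, n).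
Proof.
pose X : {poly {poly A}} := 'X%:P; pose Y : {poly {poly A}} := 'X.
have lhsE : umbral m.+1 F G ((1 + X) ^+ m * (1 + Y) ^+ m) =
    (\sum_(a < m.+1) F a *+ 'C(m, a)) * (\sum_(b < m.+1) G b *+ 'C(m, b)).
  have -> : (1 + X) ^+ m = ((1 + 'X) ^+ m)%:P by rewrite polyC_exp polyCD.
  have -> : (1 + Y) ^+ m = ((1 + 'X) ^+ m)^:P.
    by rewrite rmorphXn rmorphD /= map_polyX rmorph1.
  rewrite umbral_tensor.
  by congr (_ * _); apply: eq_bigr => a _; rewrite coef_expr1DX mulr_natl.
rewrite -lhsE -exprMn.
(* With [X * Y] in the middle, trinomial terms are X^i (XY)^j Y^k = X^(i+j) Y^(j+k). *)
have -> : (1 + X) * (1 + Y) = 1 + (X + X * Y + Y).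
  by rewrite mulrDl mul1r mulrDr mulr1 -addrA [Y + _]addrC.
rewrite exprDn umbral_sum; apply: eq_bigr => n _.
rewrite umbralMn expr1n mul1r trinomial_exprDn umbral_sum.
congr (_ *+ _); apply: eq_bigr => i _; rewrite umbral_sum; apply: eq_bigr => j _.
rewrite umbral_sum; apply: eq_bigr => k /eqP ijk; rewrite umbralMn.
congr (_ *+ _); rewrite exprMn mulrA -exprD -mulrA -exprD.
(* Both exponents are at most [n <= m], below the truncation bound. *)
by apply: umbral_monomial; move: (ltn_ord n); lia.
Qed.

(** The transform is triangular with diagonal entries ['C(n, n) = 1]. *)
Lemma binomial_transform_inj (V : zmodType) (u v : nat -> V) :
  (forall m,
    \sum_(n < m.+1) u n *+ 'C(m, n) = \sum_(n < m.+1) v n *+ 'C(m, n)) ->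
  u =1 v.
Proof.
move=> uv n; elim/ltn_ind: n => n IH; have := uv n.
rewrite !big_ord_recr /= binn !mulr1n.
under eq_bigr => i _ do rewrite IH //.
by move/addrI.
Qed.

Lemma horner_newton_poly (R : realType) n m :
  (newton_poly R n).[m%:R] = (m ^_ n)%:R.
Proof.
rewrite /newton_poly; elim: n => [|n IH]; first by rewrite big_ord0 hornerC.
rewrite big_ord_recr hornerM IH hornerXsubC ffactnSr natrM /=.
(* When [m < n] the natural subtraction [m - n] truncates, but then [m ^_ n] is already 0. *)
have [nm|mn] := leqP n m; first by rewrite natrB.
by rewrite ffact_small // !mul0r.
Qed.

Lemma horner_newtonI (R : realType) (f : lfin R) m :
  (newtonI f).[m%:R] = \sum_(n < m.+1) f n * n`!%:R *+ 'C(m, n).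
Proof.
have [N fN] := lfin_bounded f.
(* A common range for both sums: [f] vanishes from [N] on, and ['C(m, n)] for [n > m]. *)
have lmM : (m.+1 <= maxn N m.+1)%N by exact: leq_maxr.
rewrite (@newtonI_widen _ f (maxn N m.+1)) => [|n]; last first.
  by rewrite geq_max => /andP[/fN].
rewrite horner_sum (big_ord_widen _ (fun n => f n * n`!%:R *+ 'C(m, n)) lmM).
rewrite [RHS]big_mkcond; apply: eq_bigr => n _.
rewrite hornerZ horner_newton_poly -bin_ffact natrM
  [X in _ * X]mulrC mulrA !mulr_natr.
by case: ltnP => // mn; rewrite bin_small ?mulr0n.
Qed.

Theorem theorem3p2 (R : realType) (f g : lfin R) (n : nat) :
  star f g n =
  \sum_(i < n.+1) \sum_(j < n.+1) \sum_(k < n.+1 | (i + j + k == n)%N)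
    (((i + j)`! * (j + k)`!)%N%:R / (i`! * j`! * k`!)%N%:R)
      * f (i + j)%N * g (j + k)%N.
Proof.
have fact_neq0 k : k`!%:R != 0 :> R[i]%C by rewrite pnatr_eq0 -lt0n fact_gt0.
apply: (mulIf (fact_neq0 n)).
pose F a := f a * a`!%:R; pose G b := g b * b`!%:R.
transitivity (\sum_(i < n.+1) \sum_(j < n.+1) \sum_(k < n.+1 | (i + j + k == n)%N)
      F (i + j)%N * G (j + k)%N *+ ('C(n, i) * 'C(n - i, j))).
  (* As sequences in [n], both sides have as binomial transform at [m] the value of
     [newtonI f * newtonI g] at [m]. *)
  move: n; apply: binomial_transform_inj => m.
  by rewrite -binomial_transformM -!horner_newtonI -hornerM newtonI_invK.
rewrite mulr_suml; apply: eq_bigr => i _; rewrite mulr_suml; apply: eq_bigr => j _.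
rewrite mulr_suml; apply: eq_bigr => k /eqP ijk.
have : (i`! * j`! * k`!)%:R != 0 :> R[i]%C by rewrite !natrM !mulf_neq0.
(* Here n! splits into the two binomials times i! j! k!, which cancels the denominator. *)
rewrite -(trinomial_coefE ijk) -[LHS]mulr_natr /F /G.
move: ('C(n, i) * _)%N (_ * k`!)%N => c d d0.
by rewrite !natrM; field.
Qed.
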